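(* Let $\vec a=(a^1,\dots,a^{m+1})$ be a tuple of positive integers and $\vec b=(b_1,\dots,b_n)$ a tuple of positive integers (so that $\mathbb{P}^{m|n}_{\mathbb{C}}(\vec a|\vec b)$ is a positive, weighted projective superspace), and suppose $b_j\geq a^\sigma$ for all $j$ and $\sigma$. Then any homogeneously non-reduced subvariety of $\mathbb{P}^{m|n}_{\mathbb{C}}(\vec a|\vec b)$ is homogeneously non-split.
   Context: $\mathbb{C}[x|\theta]=\mathbb{C}[x^1,\dots,x^{m+1}]\otimes\wedge^\bullet(\theta_1,\dots,\theta_n)$ is the polynomial superalgebra with commuting even variables $x^\mu$ and anticommuting odd variables $\theta_j$. It is the homogeneous coordinate ring of the weighted projective superspace $\mathbb{P}^{m|n}_{\mathbb{C}}(\vec a|\vec b)$, the quotient of $\mathbb{C}^{m+1|n}-\{(0|0)\}$ by the action $(x^\mu|\theta_j)\mapsto(\lambda^{a^\mu}x^\mu|\lambda^{b_j}\theta_j)$, $\lambda\in\mathbb{C}^\times$; accordingly $x^\mu$ has weight $a^\mu$ and $\theta_j$ has weight $b_j$, and homogeneity is with respect to this action. It is called positive if all $b_j$ are positive. A polynomial $f(x|\theta)$ is irreducible if $f(x|0)\in\mathbb{C}[x]$ is irreducible; it is even if all its terms have even degree in the odd variables. A subvariety is $V(F)=\{f^\alpha(x|\theta)=0\ \forall\alpha\}$ for $F=(f^\alpha)$ a finite collection of even, irreducible, homogeneous polynomials in $\mathbb{C}[x|\theta]$. $V(F)$ is homogeneously non-reduced if there is at least one $\alpha$ and one $k$ with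 $\partial f^\alpha/\partial\theta_k\neq0$; otherwise it is homogeneously reduced. $V(F)$ is homogeneously split if there exists an automorphism $\varphi$ of the ($\mathbb{Z}_2$-graded, supercommutative) algebra $\mathbb{C}[x|\theta]$ such that: (i) the induced map $\overline\varphi:\mathbb{C}[x|\theta]/(\theta^2)\to\mathbb{C}[x|\theta]/(\theta^2)$ is the identity, where $(\theta^2)$ is the ideal generated by all products $\theta_i\theta_j$; (ii) $\varphi$ preserves weights, i.e. $\varphi(x^\mu)$ is homogeneous of the same weight as $x^\mu$ and $\varphi(\theta_j)$ is homogeneous of the same weight as $\theta_j$; (iii) $V(F\circ\varphi)=\{(f^\alpha\circ\varphi)(x|\theta)=0\ \forall\alpha\}$ is homogeneously reduced, where $f^\alpha\circ\varphi=f^\alpha(\varphi(x)|\varphi(\theta))$. Otherwise $V(F)$ is homogeneously non-split. *)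

(* Defs.v *)
From HB Require Import structures.
From mathcomp Require Import all_boot all_order all_algebra.
From mathcomp Require Import complex mpoly.
From mathcomp Require Import reals.

Set Implicit Arguments.
Unset Strict Implicit.
Unset Printing Implicit Defensive.

Import Order.TTheory GRing.Theory Num.Theory.
Local Open Scope ring_scope.

(* An element of K[x^1,...,x^p | theta_1,...,theta_n] is stored through its
   coefficients f_S in K[x^1,...,x^p]:
     f = \sum_S f_S theta_S   with   theta_S = theta_(s_1) ... theta_(s_k)
   for S = {s_1 < ... < s_k}. *)
Record superpoly (K : fieldType) (p n : nat) :=
  SuperPoly { scoef : {ffun {set 'I_n} -> {mpoly K[p]}} }.
Arguments scoef : simpl never.

Notation "{ 'superpoly' K [ p | n ] }" := (superpoly K p n)
  (at level 0, K at level 2, p, n at level 99,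
   format "{ 'superpoly'  K [ p | n ] }") : type_scope.

Section SuperPolyAlgebra.
Variables (K : fieldType) (p n : nat).
Local Notation A := {mpoly K[p]}.
Local Notation SP := {superpoly K[p|n]}.
Implicit Types (f g h : SP) (S T U : {set 'I_n}).

HB.instance Definition _ := [isNew for @scoef K p n].
HB.instance Definition _ := [Choice of SP by <:].

Lemma superpolyP f g : (forall S, scoef f S = scoef g S) -> f = g.
Proof. by move=> e; apply/val_inj/ffunP. Qed.

Definition sp_of (F : {set 'I_n} -> A) : SP := SuperPoly [ffun S => F S].

Lemma scoefE F S : scoef (sp_of F) S = F S.
Proof. by rewrite ffunE. Qed.

Definition sp_zero : SP := sp_of (fun=> 0).
Definition sp_opp f : SP := sp_of (fun S => - scoef f S).
Definition sp_add f g : SP := sp_of (fun S => scoef f S + scoef g S).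

Fact sp_addA : associative sp_add.
Proof. by move=> f g h; apply/superpolyP=> S; rewrite !scoefE addrA. Qed.
Fact sp_addC : commutative sp_add.
Proof. by move=> f g; apply/superpolyP=> S; rewrite !scoefE addrC. Qed.
Fact sp_add0 : left_id sp_zero sp_add.
Proof. by move=> f; apply/superpolyP=> S; rewrite !scoefE add0r. Qed.
Fact sp_addN : left_inverse sp_zero sp_opp sp_add.
Proof. by move=> f; apply/superpolyP=> S; rewrite !scoefE addNr. Qed.

HB.instance Definition _ :=
  GRing.isZmodule.Build SP sp_addA sp_addC sp_add0 sp_addN.

Definition sp_scale (c : K) f : SP := sp_of (fun S => c *: scoef f S).

Fact sp_scaleA c d f : sp_scale c (sp_scale d f) = sp_scale (c * d) f.
Proof. by apply/superpolyP=> S; rewrite !scoefE scalerA. Qed.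
Fact sp_scale1 : left_id 1 sp_scale.
Proof. by move=> f; apply/superpolyP=> S; rewrite !scoefE scale1r. Qed.
Fact sp_scaleDr : right_distributive sp_scale +%R.
Proof. by move=> c f g; apply/superpolyP=> S; rewrite !scoefE scalerDr. Qed.
Fact sp_scaleDl f : {morph sp_scale^~ f : c d / c + d}.
Proof. by move=> c d; apply/superpolyP=> S; rewrite !scoefE scalerDl. Qed.

HB.instance Definition _ :=
  GRing.Zmodule_isLmodule.Build K SP sp_scaleA sp_scale1 sp_scaleDr sp_scaleDl.

Lemma scoef0 S : scoef (0 : SP) S = 0. Proof. exact: scoefE. Qed.
Lemma scoefD f g S : scoef (f + g) S = scoef f S + scoef g S.
Proof. exact: scoefE. Qed.
Lemma scoefN f S : scoef (- f) S = - scoef f S. Proof. exact: scoefE. Qed.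
Lemma scoefZ c f S : scoef (c *: f) S = c *: scoef f S.
Proof. exact: scoefE. Qed.
Lemma scoef_sum I (r : seq I) (P : pred I) (E : I -> SP) S :
  scoef (\sum_(i <- r | P i) E i) S = \sum_(i <- r | P i) scoef (E i) S.
Proof.
by apply: (big_morph (fun f => scoef f S)) => [f g|]; rewrite ?scoefD ?scoef0.
Qed.

(* The number of transpositions that sort the word theta_S theta_T, so that
   theta_S theta_T = (-1)^(inversions S T) theta_(S :|: T) if S and T are
   disjoint. *)
Definition inversions S T : nat := (\sum_(i in S) \sum_(j in T) (j < i))%N.

Definition sp_one : SP := sp_of (fun S => (S == set0)%:R).

Definition sp_mul f g : SP :=
  sp_of (fun U => \sum_(S : {set 'I_n} | S \subset U)
    (-1) ^+ inversions S (U :\: S) * (scoef f S * scoef g (U :\: S))).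

Lemma inversions0l T : inversions set0 T = 0%N.
Proof. by rewrite /inversions big_set0. Qed.
Lemma inversions0r S : inversions S set0 = 0%N.
Proof. by rewrite /inversions big1 // => i _; rewrite big_set0. Qed.

Lemma sum_setU S T (E : 'I_n -> nat) : [disjoint S & T] ->
  (\sum_(i in S :|: T) E i = \sum_(i in S) E i + \sum_(i in T) E i)%N.
Proof.
move=> d; rewrite -bigU //; apply: eq_bigl => i.
by rewrite !inE.
Qed.

Lemma setU_setD S T : S \subset T -> S :|: (T :\: S) = T.
Proof.
move=> /setUidPr e; rewrite -{2}e; apply/setP=> i; rewrite !inE.
by case: (i \in S).
Qed.

Lemma disj_setD S T : [disjoint S & T :\: S].
Proof.
by rewrite -setI_eq0; apply/eqP/setP=> i; rewrite !inE; case: (i \in S).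
Qed.

Lemma setU_disjK S T : [disjoint S & T] -> (S :|: T) :\: S = T.
Proof.
by move=> d; rewrite setDUl setDv set0U; apply/setDidPl; rewrite disjoint_sym.
Qed.

Lemma inversionsUl S T U : [disjoint S & T] ->
  inversions (S :|: T) U = (inversions S U + inversions T U)%N.
Proof. exact: sum_setU. Qed.
Lemma inversionsUr S T U : [disjoint T & U] ->
  inversions S (T :|: U) = (inversions S T + inversions S U)%N.
Proof.
move=> d; rewrite /inversions -big_split; apply: eq_bigr => i _.
exact: sum_setU.
Qed.

Fact sp_mulA : associative sp_mul.
Proof.
move=> f g h; apply/superpolyP=> U; rewrite !scoefE.
pose t S T := (-1) ^+ (inversions S T
    + inversions S (U :\: (S :|: T)) + inversions T (U :\: (S :|: T)))
  * (scoef f S * (scoef g T * scoef h (U :\: (S :|: T)))).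
transitivity (\sum_(S : {set 'I_n} | S \subset U)
    \sum_(T : {set 'I_n} | T \subset U :\: S) t S T).
  apply: eq_bigr => S sSU; rewrite scoefE !mulr_sumr.
  apply: eq_bigr => T sT; rewrite /t -setDDl.
  rewrite -{1}(setU_setD sT) inversionsUr ?disj_setD //.
  rewrite !exprD -!mulrA; congr (_ * (_ * _)).
  by rewrite mulrCA.
rewrite [RHS](eq_bigr (fun S : {set 'I_n} => \sum_(T : {set 'I_n} | T \subset S)
   (-1) ^+ inversions S (U :\: S) * ((-1) ^+ inversions T (S :\: T) *
    (scoef f T * scoef g (S :\: T)) * scoef h (U :\: S)))); last first.
  by move=> S _; rewrite scoefE mulr_suml mulr_sumr.
rewrite [RHS](exchange_big_dep (fun T : {set 'I_n} => T \subset U)) /=; last first.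
  by move=> S T sSU sTS; exact: (subset_trans sTS sSU).
apply: eq_bigr => S sSU.
rewrite [RHS](reindex_onto (fun T => S :|: T) (fun T => T :\: S)); last first.
  by move=> T /andP[_ sST]; rewrite setU_setD.
apply: eq_big => [T|T].
  rewrite subUset sSU subsetUl /= subsetD andbT; congr (_ && _).
  apply/idP/eqP => [d|<-].
    by rewrite setU_disjK // disjoint_sym.
  by rewrite disjoint_sym disj_setD.
rewrite subsetD => /andP[sTU dTS].
have dST : [disjoint S & T] by rewrite disjoint_sym.
rewrite /t setU_disjK // inversionsUl // !exprD.
set x := (-1) ^+ _; set y := (-1) ^+ _; set z := (-1) ^+ _.
rewrite -!mulrA mulrCA; congr (_ * _); exact: mulrCA.
Qed.

Fact sp_mul1l : left_id sp_one sp_mul.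
Proof.
move=> f; apply/superpolyP=> U; rewrite scoefE.
rewrite (bigD1 set0) ?sub0set //= scoefE eqxx setD0 inversions0l expr0 !mul1r.
rewrite big1 ?addr0 // => S /andP[_ nS]; rewrite scoefE (negPf nS).
by rewrite mul0r mulr0.
Qed.

Fact sp_mul1r : right_id sp_one sp_mul.
Proof.
move=> f; apply/superpolyP=> U; rewrite scoefE.
rewrite (bigD1 U) //= setDv inversions0r expr0 scoefE eqxx mul1r mulr1.
rewrite big1 ?addr0 // => S /andP[sSU nS]; rewrite scoefE.
rewrite setD_eq0; case: (boolP (U \subset S)) => [sUS|_]; last by rewrite !mulr0.
by rewrite eqEsubset sSU sUS in nS.
Qed.

Fact sp_mulDl : left_distributive sp_mul +%R.
Proof.
move=> f g h; apply/superpolyP=> U; rewrite scoefD !scoefE -big_split.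
by apply: eq_bigr => S _; rewrite scoefD mulrDl mulrDr.
Qed.

Fact sp_mulDr : right_distributive sp_mul +%R.
Proof.
move=> f g h; apply/superpolyP=> U; rewrite scoefD !scoefE -big_split.
by apply: eq_bigr => S _; rewrite scoefD !mulrDr.
Qed.

Fact sp_one_neq0 : sp_one != 0.
Proof.
apply/eqP => /(congr1 (fun f => scoef f set0)).
by rewrite scoef0 scoefE eqxx; apply/eqP; rewrite oner_eq0.
Qed.

HB.instance Definition _ := GRing.Zmodule_isNzRing.Build SP
  sp_mulA sp_mul1l sp_mul1r sp_mulDl sp_mulDr sp_one_neq0.

Lemma scoefM f g U : scoef (f * g) U = \sum_(S : {set 'I_n} | S \subset U)
  (-1) ^+ inversions S (U :\: S) * (scoef f S * scoef g (U :\: S)).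
Proof. exact: scoefE. Qed.

Fact sp_scaleAl (c : K) f g : c *: (f * g) = c *: f * g.
Proof.
apply/superpolyP=> U; rewrite scoefZ !scoefM scaler_sumr.
by apply: eq_bigr => S _; rewrite scoefZ -scalerAl scalerAr.
Qed.
HB.instance Definition _ := GRing.Lmodule_isLalgebra.Build K SP sp_scaleAl.

Fact sp_scaleAr (c : K) f g : c *: (f * g) = f * (c *: g).
Proof.
apply/superpolyP=> U; rewrite scoefZ !scoefM scaler_sumr.
by apply: eq_bigr => S _; rewrite scoefZ -!scalerAr.
Qed.
HB.instance Definition _ := GRing.Lalgebra_isAlgebra.Build K SP sp_scaleAr.

Definition sp_x (mu : 'I_p) : SP :=
  sp_of (fun S => if S == set0 then 'X_mu else 0).
Definition sp_theta (j : 'I_n) : SP := sp_of (fun S => (S == [set j])%:R).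

Definition sp_even f := forall S, scoef f S != 0 -> ~~ odd #|S|.
Definition sp_odd f := forall S, scoef f S != 0 -> odd #|S|.

(* f(x|0) *)
Definition sp_body f : A := scoef f set0.

(* The left derivative with respect to theta_k:
   theta_(k |: S) = (-1)^(inversions [set k] S) theta_k theta_S. *)
Definition sp_dtheta (k : 'I_n) f : SP :=
  sp_of (fun S => if k \in S then 0
                  else (-1) ^+ inversions [set k] S * scoef f (k |: S)).

(* f(x'|theta'); it is the usual substitution when the x' are even and the
   theta' are odd, the order of the factors being that of theta_S. *)
Definition sp_subst (x' : 'I_p -> SP) (theta' : 'I_n -> SP) f : SP :=
  \sum_(S : {set 'I_n})
    mmap (in_alg SP) x' (scoef f S) * \prod_(j < n | j \in S) theta' j.

(* The ideal (theta^2): the products theta_i theta_j are central, so left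
   multiples are enough. *)
Definition in_theta2 f := exists c : 'I_n -> 'I_n -> SP,
  f = \sum_(i < n) \sum_(j < n) c i j * (sp_theta i * sp_theta j).

(* Automorphisms of the Z/2-graded algebra. *)
Definition sp_automorphism (phi : {lrmorphism SP -> SP}) :=
  [/\ bijective phi, forall f, sp_even f -> sp_even (phi f)
    & forall f, sp_odd f -> sp_odd (phi f)].

(* f o phi = f(phi(x)|phi(theta)) *)
Definition sp_comp f (phi : SP -> SP) : SP :=
  sp_subst (fun mu => phi (sp_x mu)) (fun j => phi (sp_theta j)) f.

End SuperPolyAlgebra.

Definition irreducible_elt (D : idomainType) (q : D) :=
  [/\ q != 0, q \isn't a GRing.unit
    & forall u v : D, q = u * v -> u \is a GRing.unit \/ v \is a GRing.unit].

Section Subvarieties.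
Variables (R : realType) (p n : nat) (a : 'I_p -> nat) (b : 'I_n -> nat).
Local Notation SP := {superpoly R[i][p|n]}.

(* f has weight w for the action (x|theta) |-> (l^a x | l^b theta). *)
Definition homogeneous (w : nat) (f : SP) := forall l : R[i], l != 0 ->
  sp_subst (fun mu => l ^+ a mu *: sp_x _ _ mu)
           (fun j => l ^+ b j *: sp_theta _ _ j) f = l ^+ w *: f.

Definition sp_irreducible (f : SP) := irreducible_elt (sp_body f).

(* A subvariety V(F) is given by its finite family F of equations. *)
Definition is_subvariety (r : nat) (F : 'I_r -> SP) := forall alpha,
  [/\ sp_even (F alpha), sp_irreducible (F alpha)
    & exists w, homogeneous w (F alpha)].

Definition homog_nonreduced (r : nat) (F : 'I_r -> SP) :=
  exists alpha k, sp_dtheta k (F alpha) != 0.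
Definition homog_reduced (r : nat) (F : 'I_r -> SP) := ~ homog_nonreduced F.

Definition preserves_weights (phi : SP -> SP) :=
  (forall mu, homogeneous (a mu) (phi (sp_x _ _ mu))) /\
  (forall j, homogeneous (b j) (phi (sp_theta _ _ j))).

(* phi f = f modulo (theta^2) for all f says that phi induces the identity of
   C[x|theta] / (theta^2). *)
Definition homog_split (r : nat) (F : 'I_r -> SP) :=
  exists phi : {lrmorphism SP -> SP},
    [/\ sp_automorphism phi,
        forall f, in_theta2 (phi f - f),
        preserves_weights phi
      & homog_reduced (fun alpha => sp_comp (F alpha) phi)].
Definition homog_nonsplit (r : nat) (F : 'I_r -> SP) := ~ homog_split F.

End Subvarieties.

(* Main.v *)
(* Since b_i + b_j > a^mu for all i, j, mu, no monomial of weight a^mu lies in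
   (theta^2), so a weight-preserving phi inducing the identity modulo (theta^2)
   fixes every x^mu, hence all of C[x]. If f o phi = phi(f) is free of theta, it
   is some G(x) = phi(G(x)), and injectivity of phi gives f = G(x). *)
Require Import Defs.
From HB Require Import structures.
From mathcomp Require Import all_boot all_order all_algebra.
From mathcomp Require Import complex mpoly.
From mathcomp Require Import reals.

Set Implicit Arguments.
Unset Strict Implicit.
Unset Printing Implicit Defensive.

Import GRing.Theory Num.Theory.
Local Open Scope ring_scope.

Section SuperPolyTheory.
Variables (K : fieldType) (p n : nat).
Local Notation A := {mpoly K[p]}.
Local Notation SP := {superpoly K[p|n]}.
Implicit Types (f g : SP) (q r : A) (S T U : {set 'I_n}) (j : 'I_n).

Definition sp_monom q S : SP := sp_of (fun T => if T == S then q else 0).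

Lemma scoef_monom q S T :
  scoef (sp_monom q S) T = if T == S then q else 0.
Proof. exact: scoefE. Qed.

(** Without inversions the word theta_S theta_T is already sorted, so no sign appears; in the
    convolution only the splitting of [S :|: T] into [S] and [T] survives. *)
Lemma sp_monomM q r S T : [disjoint S & T] -> inversions S T = 0%N ->
  sp_monom q S * sp_monom r T = sp_monom (q * r) (S :|: T).
Proof.
move=> dST inv0; apply/superpolyP=> U; rewrite scoefM scoef_monom.
have [->|neU] := eqVneq U (S :|: T).
  rewrite (bigD1 S) ?subsetUl //= setU_disjK // inv0 expr0 !scoef_monom !eqxx.
  rewrite mul1r big1 ?addr0 // => S' /andP[_ neS].
  by rewrite scoef_monom (negPf neS) mul0r mulr0.
rewrite big1 // => S' sS'U; rewrite !scoef_monom.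
have [eS|_] := eqVneq S' S; last by rewrite mul0r mulr0.
have [eT|_] := eqVneq (U :\: S') T; last by rewrite !mulr0.
by rewrite -eS -eT setU_setD ?eqxx in neU.
Qed.

Lemma sp_theta_monom j : sp_theta K p j = sp_monom 1 [set j].
Proof.
by apply/superpolyP=> T; rewrite scoef_monom scoefE; case: eqP.
Qed.

Lemma sp_one_monom : 1 = sp_monom 1 set0.
Proof.
by apply/superpolyP=> T; rewrite scoef_monom scoefE; case: eqP.
Qed.

Definition sp_const q : SP := sp_monom q set0.

Fact sp_const_is_zmod_morphism : zmod_morphism sp_const.
Proof.
move=> q r; apply/superpolyP=> T.
by rewrite scoefD scoefN !scoef_monom; case: eqP; rewrite ?subrr.
Qed.

Fact sp_const_is_monoid_morphism : monoid_morphism sp_const.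
Proof.
split=> [|q r]; first by rewrite /sp_const -sp_one_monom.
by rewrite /sp_const sp_monomM ?setU0 ?inversions0l // -setI_eq0 set0I.
Qed.

HB.instance Definition _ :=
  GRing.isZmodMorphism.Build A SP sp_const sp_const_is_zmod_morphism.
HB.instance Definition _ :=
  GRing.isMonoidMorphism.Build A SP sp_const sp_const_is_monoid_morphism.

Lemma sp_constZ (c : K) q : sp_const (c *: q) = c *: sp_const q.
Proof.
apply/superpolyP=> T; rewrite scoefZ !scoef_monom.
by case: eqP; rewrite ?scaler0.
Qed.

Lemma sp_const_theta q S : sp_const q * sp_monom 1 S = sp_monom q S.
Proof.
by rewrite sp_monomM ?set0U ?mulr1 ?inversions0l // -setI_eq0 set0I.
Qed.

Lemma sp_sum_monom f : f = \sum_(S : {set 'I_n}) sp_monom (scoef f S) S.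
Proof.
apply/superpolyP=> T; rewrite scoef_sum (bigD1 T) //= scoef_monom eqxx.
by rewrite big1 ?addr0 // => S neS; rewrite scoef_monom eq_sym (negPf neS).
Qed.

(** By induction: the head of an increasing word lies below its whole tail, so prepending it creates
    no inversion and the sign stays +1. *)
Lemma prod_theta_sorted (s : seq 'I_n) : sorted (relpre val ltn) s ->
  \prod_(j <- s) sp_theta K p j = sp_monom 1 [set j in s].
Proof.
elim: s => [_|i s IHs /= path_s].
  by rewrite big_nil sp_one_monom; congr sp_monom; apply/setP=> j; rewrite !inE.
have ltis j : j \in s -> (i < j)%N.
  move: path_s; rewrite path_sortedE; last by move=> y x z; apply: ltn_trans.
  by case/andP=> /allP lt_s _ /lt_s.
rewrite big_cons IHs ?(path_sorted path_s) // sp_theta_monom sp_monomM ?mulr1.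
- by congr sp_monom; apply/setP=> j; rewrite !inE.
- by rewrite disjoints1 inE; apply/negP=> /ltis; rewrite ltnn.
rewrite /inversions big_set1 big1 // => j; rewrite inE => /ltis lt_ij.
by rewrite ltnNge ltnW.
Qed.

Lemma prod_theta S : \prod_(j < n | j \in S) sp_theta K p j = sp_monom 1 S.
Proof.
rewrite -big_filter prod_theta_sorted.
  congr sp_monom; apply/setP=> j.
  by rewrite inE mem_filter mem_index_enum andbT.
apply: sorted_filter; first by move=> j i k /=; apply: ltn_trans.
(* The big product runs through the indices in increasing order, since their values form an
   [iota]. *)
by rewrite [index_enum _]unlock -sorted_map -enumT val_enum_ord iota_ltn_sorted.
Qed.

Lemma mmap_scale_x (c : 'I_p -> K) q :
  mmap (in_alg SP) (fun mu => c mu *: sp_x K n mu) q =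
  sp_const (\sum_(m <- msupp q) (q@_m * \prod_i c i ^+ m i) *: 'X_[m]).
Proof.
rewrite raddf_sum; apply: eq_bigr => m _ /=.
rewrite mpolyXE_id -scalerA !sp_constZ mulr_algl; congr (_ *: _).
rewrite -sp_constZ -scaler_prod rmorph_prod; apply: eq_bigr => i _.
by rewrite -exprZn rmorphXn /= sp_constZ.
Qed.

(** Rescaling the variables is diagonal in the basis x^m theta_S. This turns homogeneity into a
    condition on each monomial separately. *)
Lemma mcoeff_scoef_subst_scale (c : 'I_p -> K) (d : 'I_n -> K) f S m :
  (scoef (sp_subst (fun mu => c mu *: sp_x K n mu)
                   (fun j => d j *: sp_theta K p j) f) S)@_m
  = (\prod_(j in S) d j * \prod_i c i ^+ m i) * (scoef f S)@_m.
Proof.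
(* Rescaling does not change the odd part of a monomial, so only the summand of [S] reaches
   theta_S. *)
rewrite /sp_subst scoef_sum (bigD1 S) //= [X in _ + X]big1 => [|T neT].
  rewrite addr0 mmap_scale_x scaler_prod prod_theta -scalerAr sp_const_theta.
  rewrite scoefZ scoef_monom eqxx mcoeffZ raddf_sum /= -mulrA; congr (_ * _).
  rewrite (eq_bigr (fun m' => (scoef f S)@_m' * \prod_i c i ^+ m' i
                              * (m' == m)%:R)) => [|m' _]; last first.
    by rewrite mcoeffZ mcoeffX.
  have [m_supp|m_nsupp] := boolP (m \in msupp (scoef f S)).
    rewrite (bigD1_seq m) ?msupp_uniq //= eqxx mulr1 [X in _ + X]big1.
      by rewrite addr0 mulrC.
    by move=> m' /negPf ->; rewrite mulr0.
  rewrite (memN_msupp_eq0 m_nsupp) mulr0 big_seq big1 // => m' m'_supp.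
  case: eqP => [em|_]; last by rewrite mulr0.
  by rewrite -em m'_supp in m_nsupp.
rewrite mmap_scale_x scaler_prod prod_theta -scalerAr sp_const_theta.
by rewrite scoefZ scoef_monom eq_sym (negPf neT) scaler0.
Qed.

Lemma mmap_x q : mmap (in_alg SP) (fun mu => sp_x K n mu) q = sp_const q.
Proof.
rewrite [in RHS](mpolyE q) raddf_sum; apply: eq_bigr => m _ /=.
rewrite mpolyXE_id sp_constZ mulr_algl rmorph_prod; congr (_ *: _).
by apply: eq_bigr => i _; rewrite rmorphXn.
Qed.

(** An algebra morphism is determined by the images of the generators, and the substitution keeps
    the order of the odd factors. Hence injectivity of [phi] can be applied to f o phi. *)
Lemma sp_comp_lrmorphism (phi : {lrmorphism SP -> SP}) f :
  sp_comp f phi = phi f.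
Proof.
rewrite /sp_comp /sp_subst [in RHS](sp_sum_monom f) rmorph_sum.
apply: eq_bigr => S _; rewrite -sp_const_theta rmorphM -mmap_x -prod_theta.
rewrite rmorph_prod; congr (_ * _); rewrite /mmap rmorph_sum.
apply: eq_bigr => m _; rewrite rmorphM /= linearZ rmorph1; congr (_ * _).
by rewrite rmorph_prod; apply: eq_bigr => i _; rewrite rmorphXn.
Qed.

(** Coefficientwise form of lying in the k-th power of the ideal generated by the odd variables;
    unlike [in_theta2], it carries no witnesses. *)
Definition theta_order k f :=
  forall S, (#|S| < k)%N -> scoef f S = 0.

(** If [U] has fewer than k + l elements and splits into [S] and [U :\: S], then the first has fewer
    than k elements or the second fewer than l. *)
Lemma theta_orderM k l f g :
  theta_order k f -> theta_order l g -> theta_order (k + l) (f * g).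
Proof.
move=> ok_f ol_g U ltU; rewrite scoefM big1 // => S sSU.
have [ltS|leS] := ltnP #|S| k; first by rewrite ok_f // mul0r mulr0.
rewrite ol_g ?mulr0 //; move: ltU; rewrite -(setU_setD sSU).
rewrite cardsU disjoint_setI0 ?disj_setD // cards0 subn0 setU_setD // => ltU.
by rewrite -(ltn_add2l k) (leq_ltn_trans _ ltU) // leq_add2r.
Qed.

Lemma in_theta2_order f : in_theta2 f -> theta_order 2 f.
Proof.
have theta1 j : theta_order 1 (sp_theta K p j).
  move=> S; rewrite sp_theta_monom scoef_monom; case: eqP => // ->.
  by rewrite cards1.
case=> c -> S ltS; rewrite scoef_sum big1 // => i _.
(* The arbitrary coefficient [c i j] has order 0 vacuously; each of the two odd variables
   contributes 1. *)
rewrite scoef_sum big1 // => j _; apply: (@theta_orderM 0 (1 + 1)) ltS => //.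
exact: theta_orderM.
Qed.

(** For k in S, the coefficient of theta_S in f is, up to sign, that of theta_(S minus k) in the
    derivative along theta_k; only the body escapes all derivatives. *)
Lemma sp_dtheta_eq0 f :
  (forall k, sp_dtheta k f = 0) -> f = sp_const (sp_body f).
Proof.
move=> df0; apply/superpolyP=> S; rewrite scoef_monom.
have [->|/set0Pn[k kS]] := eqVneq S set0; first by [].
have /eqP := congr1 (fun g => scoef g (S :\ k)) (df0 k).
rewrite scoef0 scoefE !inE eqxx /= setD1K // mulf_eq0 signr_eq0 /=.
by move/eqP.
Qed.

Lemma sp_dtheta_const q k : sp_dtheta k (sp_const q) = 0.
Proof.
apply/superpolyP=> S; rewrite scoefE scoef0 scoef_monom.
case: ifP => // _; case: eqP => [/setP/(_ k)|_]; last by rewrite mulr0.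
by rewrite !inE eqxx.
Qed.

Lemma lrmorphism_const (phi : {lrmorphism SP -> SP}) q :
  (forall mu, phi (sp_x K n mu) = sp_x K n mu) ->
  phi (sp_const q) = sp_const q.
Proof.
move=> fix_x; rewrite -mmap_x rmorph_sum; apply: eq_bigr => m _.
rewrite rmorphM /= linearZ rmorph1; congr (_ * _).
by rewrite rmorph_prod; apply: eq_bigr => i _; rewrite rmorphXn /= fix_x.
Qed.

End SuperPolyTheory.

Section Weights.
Variables (R : realType) (p n : nat) (a : 'I_p -> nat) (b : 'I_n -> nat).
Local Notation SP := {superpoly R[i] [p|n]}.

(** The action scales each monomial by its own power of l, which must equal l^w whenever the
    monomial occurs in f. *)
Lemma homogeneous_weight w (f : SP) S m :
  homogeneous a b w f -> (scoef f S)@_m != 0 ->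
  w = (\sum_(j in S) b j + \sum_i a i * m i)%N.
Proof.
(* The single scalar l = 2 suffices: its powers are pairwise distinct, so the exponents can be
   compared. *)
move=> hom_f f_neq0; have two_neq0 : 2 != 0 :> R[i] by rewrite pnatr_eq0.
have := congr1 (fun g => (scoef g S)@_m) (hom_f 2 two_neq0).
rewrite mcoeff_scoef_subst_scale scoefZ mcoeffZ => /(mulIf f_neq0).
rewrite prodrXr.
rewrite (eq_bigr (fun i => 2 ^+ (a i * m i))) => [|i _]; last by rewrite exprM.
rewrite prodrXr -exprD => /ieexprIn -> //.
by rewrite (eqr_nat _ 2 1).
Qed.

(** Congruence modulo (theta^2) settles the coefficients with at most one odd variable; the weight
    bound kills all the others. *)
Lemma homogeneous_theta2_eq mu (f : SP) :
  (0 < a mu)%N -> (forall j, a mu <= b j)%N ->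
  homogeneous a b (a mu) f -> in_theta2 (f - sp_x _ _ mu) -> f = sp_x _ _ mu.
Proof.
move=> a_gt0 le_ab hom_f /in_theta2_order ord_f; apply/superpolyP=> S.
have [ltS|leS] := ltnP #|S| 2.
  by apply/eqP; rewrite -subr_eq0 -scoefN -scoefD ord_f.
rewrite scoef_monom; case: eqP leS => [->|_ leS]; first by rewrite cards0.
apply/mpolyP=> m; rewrite mcoeff0; apply/eqP/negPn/negP=> f_neq0.
have /eqP := homogeneous_weight hom_f f_neq0; apply/negP.
(* The chain is a_mu < 2 a_mu <= |S| a_mu <= sum of b_j over S; the strict step uses a_mu > 0. *)
rewrite neq_ltn (@leq_trans (#|S| * a mu)) //.
  by rewrite (leq_trans _ (leq_mul leS (leqnn _))) // ltn_Pmull.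
rewrite -sum_nat_const (leq_trans _ (leq_addr _ _)) //.
by apply: leq_sum => j _.
Qed.

End Weights.

Theorem theorem4p12 (R : realType) (m n : nat)
    (a : 'I_m.+1 -> nat) (b : 'I_n -> nat)
    (a_gt0 : forall mu, (0 < a mu)%N)
    (b_gt0 : forall j, (0 < b j)%N)
    (le_ab : forall j sigma, (a sigma <= b j)%N)
    (r : nat) (F : 'I_r -> {superpoly R[i] [m.+1|n]})
    (F_subvariety : is_subvariety a b F) :
  homog_nonreduced F -> homog_nonsplit a b F.
Proof.
move=> [alpha [k dF_neq0]] [phi [[phi_bij _ _] phi_theta2 [hom_x _] red_phi]].
have fix_x mu : phi (sp_x _ _ mu) = sp_x _ _ mu.
  exact: homogeneous_theta2_eq (a_gt0 mu) (le_ab^~ mu) (hom_x mu) _.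
have phiF : phi (F alpha) = sp_const n (sp_body (phi (F alpha))).
  apply: sp_dtheta_eq0 => j; apply/eqP/negPn/negP=> dphi_neq0.
  by apply: red_phi; exists alpha, j; rewrite sp_comp_lrmorphism.
(* Both sides become values of [phi], so injectivity makes [F alpha] free of theta. *)
rewrite -(lrmorphism_const _ fix_x) in phiF.
by rewrite (bij_inj phi_bij phiF) sp_dtheta_const eqxx in dF_neq0.
Qed.
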